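(* Let $z>0$ and $n\ge 1$, and let $x_{n,1}<\cdots<x_{n,n}$ be the zeros of the monic truncated Hermite polynomial $P_n(x;z)$. Then these zeros are located at the equilibrium points of $n$ unit charged particles located in the interval $(-z,z)$ under the influence of the external potential $$V_{n}(x;z)=x^{2}-\ln\left|x^{2}-z^{2}\right|+\ln\left|x^{2}-\zeta_{n}^{2}(z)\right|,\qquad \zeta_{n}^{2}(z)=z^{2}+n+\frac{1}{2}-\gamma_{n}(z)-\gamma_{n+1}(z).$$ That is, with the total energy $$E(x_1,\ldots,x_n)=-2\sum_{1\le j<k\le n}\ln|x_k-x_j|+\sum_{k=1}^{n}V_n(x_k;z),$$ one has $\frac{\partial E}{\partial x_{k}}(x_{n,1},\ldots,x_{n,n})=0$ for all $1\le k\le n$.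
   Context: For $z>0$ let $L[p]=\int_{-z}^{z}p(x)e^{-x^{2}}dx$, $p\in\mathbb{R}[x]$. The truncated Hermite polynomials $P_n(x;z)$, $n\ge0$, are the monic polynomials in $x$ with $\deg P_n=n$ and $L[P_kP_n]=h_n(z)\delta_{k,n}$, where $h_n(z)=L[P_n^2]>0$. They satisfy the three-term recurrence $xP_n(x;z)=P_{n+1}(x;z)+\gamma_n(z)P_{n-1}(x;z)$ with $P_{-1}=0$, $P_0=1$, where $\gamma_n(z)=h_n(z)/h_{n-1}(z)$ for $n\ge1$. The zeros of $P_n(x;z)$ are real, simple and lie in $(-z,z)$. The particles interact logarithmically, and equilibrium means a critical point of the total energy $E$. *)

(* Defs.v *)
(* MathComp-Analysis, over an arbitrary R : realType. *)
From HB Require Import structures.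
From mathcomp Require Import all_boot all_order all_algebra.
From mathcomp Require Import all_classical all_reals all_analysis.

Set Implicit Arguments.
Unset Strict Implicit.
Unset Printing Implicit Defensive.

Import Order.TTheory GRing.Theory Num.Theory.
Import numFieldNormedType.Exports.

Local Open Scope ring_scope.
Local Open Scope classical_set_scope.

Definition truncL (R : realType) (z : R) (p : {poly R}) : R :=
  (\int[lebesgue_measure]_(x in `[- z, z]) (p.[x] * expR (- x ^+ 2)))%R.

Definition hnorm (R : realType) (z : R) (P : nat -> {poly R}) (n : nat) : R :=
  truncL z (P n ^+ 2).

(* These conditions determine P uniquely. The positivity of hnorm is not
   assumed: it follows, for 0 < z, from the positivity of the weight. *)
Definition truncated_hermite (R : realType) (z : R) (P : nat -> {poly R}) :
    Prop :=
  [/\ forall n, P n \is monic,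
      forall n, size (P n) = n.+1 &
      forall k n, truncL z (P k * P n) = if k == n then hnorm z P n else 0].

(* Meaningful only for 1 <= n. *)
Definition gammaP (R : realType) (z : R) (P : nat -> {poly R}) (n : nat) : R :=
  hnorm z P n / hnorm z P n.-1.

(* The real number zeta_n^2, which may be negative. *)
Definition zeta2 (R : realType) (z : R) (P : nat -> {poly R}) (n : nat) : R :=
  z ^+ 2 + n%:R + 1 / 2 - gammaP z P n - gammaP z P n.+1.

(* The library's ln is total, with value 0 outside the positive reals. *)
Definition potential (R : realType) (z : R) (P : nat -> {poly R}) (n : nat)
    (x : R) : R :=
  x ^+ 2 - ln `|x ^+ 2 - z ^+ 2| + ln `|x ^+ 2 - zeta2 z P n|.

Definition energy (R : realType) (z : R) (P : nat -> {poly R}) (n : nat)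
    (x : 'rV[R]_n) : R :=
  - 2 * (\sum_(k < n) \sum_(j < n | (j < k)%N) ln `|x 0 k - x 0 j|)
  + \sum_(k < n) potential z P n (x 0 k).

Definition increasing_zeros (R : realType) (p : {poly R}) (n : nat)
    (x : 'rV[R]_n) : Prop :=
  (forall j k : 'I_n, (j < k)%N -> x 0 j < x 0 k) /\
  (forall r : R, root p r <-> exists k : 'I_n, x 0 k = r).

(* is_derive asserts both that the k-th partial derivative exists and that it
   vanishes. *)
Definition critical_point (R : realType) (n : nat) (f : 'rV[R]_n -> R)
    (x : 'rV[R]_n) : Prop :=
  forall k : 'I_n, is_derive x (delta_mx 0 k : 'rV[R]_n) f 0.

(* Main.v *)
(* Write phi = x^2 - z^2, n = m + 1, g = gamma_n, t = zeta_n^2. As phi vanishes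
   at the endpoints, integrating (phi p e^{-x^2})' gives the Pearson identity
   L[(phi p)' - 2 x phi p] = 0. With orthogonality and parity it yields
     phi P_n' = 2 g (x^2 - t) P_m + (n - 2 g) x P_n,
     phi P_m' = (2 x phi - (n - 2 g) x) P_m + (c - 2 x^2) P_n.
   Eliminating P_m between these and the derivative of the first one gives, at
   a zero of P_n, P_n''/P_n' = 2 x - 2 x / phi + 2 x / (x^2 - t), which is V_n'.
   On the other hand P_n''/P_n' = 2 sum_j 1 / (x_k - x_j) at x_k. The first
   relation also shows that t is not the square of a zero, so that V_n is
   differentiable there. *)
Require Import Defs.
From HB Require Import structures.
From mathcomp Require Import all_boot all_order all_algebra.
From mathcomp Require Import all_classical all_reals all_analysis.
From mathcomp Require Import ring lra zify.
Import Order.TTheory GRing.Theory Num.Theory.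
Import numFieldNormedType.Exports.
Local Open Scope ring_scope.

(** * The truncated Gaussian functional *)

Section TruncatedFunctional.
Context {R : realType}.
Implicit Types (z x : R) (p q : {poly R}).

Lemma is_derive_gauss x :
  is_derive x 1 (fun y : R => expR (- y ^+ 2)) (- (2 * x) * expR (- x ^+ 2)).
Proof.
have D : is_derive x (1 : R) (fun y : R => - y ^+ 2) (- (2 * x)).
  by apply: is_derive_eq; rewrite /GRing.scale /=; ring.
rewrite [X in is_derive _ _ _ X]mulrC.
exact: (@is_derive1_comp _ expR (fun y => - y ^+ 2) _ _ _ (is_derive_expR _) D).
Qed.

Lemma is_derive_poly_gauss p x :
  is_derive x 1 (fun y : R => p.[y] * expR (- y ^+ 2))
    ((p^`() - 2%:P * 'X * p).[x] * expR (- x ^+ 2)).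
Proof.
have := is_deriveM (is_derive_poly p x) (is_derive_gauss x).
move=> D; apply: is_derive_eq => //.
by rewrite !hornerE /GRing.scale /=; ring.
Qed.

Lemma continuous_poly_gauss p :
  continuous (fun y : R => p.[y] * expR (- y ^+ 2)).
Proof.
move=> x; apply: differentiable_continuous; apply/derivable1_diffP.
by have [] := is_derive_poly_gauss p x.
Qed.

Lemma integrable_poly_gauss p (z : R) :
  lebesgue_measure.-integrable `[- z, z]%classic
    (EFin \o fun y : R => p.[y] * expR (- y ^+ 2)).
Proof.
apply: continuous_compact_integrable; first exact: segment_compact.
exact/continuous_subspaceT/continuous_poly_gauss.
Qed.

Lemma truncL0 z : truncL z 0 = 0.
Proof.
rewrite /truncL; under eq_Rintegral do rewrite horner0 mul0r.
by rewrite /Rintegral integral0.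
Qed.

Lemma truncLZ z c p : truncL z (c *: p) = c * truncL z p.
Proof.
rewrite /truncL -RintegralZl //; last exact: integrable_poly_gauss.
by apply: eq_Rintegral => x _; rewrite hornerZ mulrA.
Qed.

Lemma truncLD z p q : truncL z (p + q) = truncL z p + truncL z q.
Proof.
rewrite /truncL -RintegralD //; try exact: integrable_poly_gauss.
by apply: eq_Rintegral => x _; rewrite hornerD mulrDl.
Qed.

Lemma truncLN z p : truncL z (- p) = - truncL z p.
Proof. by rewrite -scaleN1r truncLZ mulN1r. Qed.

Lemma truncLB z p q : truncL z (p - q) = truncL z p - truncL z q.
Proof. by rewrite truncLD truncLN. Qed.

(** The interval and the weight are both invariant under $x\mapsto -x$. *)
Lemma truncL_comp_oppX z p : 0 <= z -> truncL z (p \Po (- 'X)) = truncL z p.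
Proof.
move=> z0; rewrite /truncL /Rintegral; congr fine.
have zz : - z <= z by lra.
have cG := @continuous_subspaceT _ _ `[- z, - - z]%classic _
  (continuous_poly_gauss p).
have := integration_by_substitution_oppr zz cG.
rewrite opprK => ->; apply: eq_integral => x _ /=.
by rewrite horner_comp !hornerE sqrrN.
Qed.

(** The argument of [truncL] times the weight is $(p\,e^{-x^2})'$; the weight is the same at both
    endpoints. *)
Lemma truncL_deriv z p : 0 < z ->
  truncL z (p^`() - 2%:P * 'X * p) = (p.[z] - p.[- z]) * expR (- z ^+ 2).
Proof.
move=> z0; rewrite /truncL /Rintegral.
pose F := fun y : R => p.[y] * expR (- y ^+ 2).
rewrite (@continuous_FTC2 _ _ F).
- by rewrite /F /= sqrrN -mulrBl.
- lra.
- exact/continuous_subspaceT/continuous_poly_gauss.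
- split.
  + by move=> x _; have [] := is_derive_poly_gauss p x.
  + exact/cvg_at_right_filter/continuous_poly_gauss.
  + exact/cvg_at_left_filter/continuous_poly_gauss.
- by move=> x _; rewrite derive1E; have [_ ->] := is_derive_poly_gauss p x.
Qed.

Lemma finite_roots p : p != 0 -> finite_set [set x : R | root p x]%classic.
Proof.
move=> pn0; apply: contrapT => /(infinite_set_fset (size p)) [B Bp].
apply/negP; rewrite -ltnNge; apply: max_poly_roots => //.
  by apply/allP => x xB; apply: Bp.
exact: finmap.fset_uniq.
Qed.

(** A zero integral would make the nonnegative integrand vanish almost everywhere. As [p] has
    finitely many roots, the whole interval, of length $2z>0$, would then be a null set. *)
Lemma truncL_gt0 z p : 0 < z -> p != 0 ->
  (forall x, - z <= x <= z -> 0 <= p.[x]) -> 0 < truncL z p.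
Proof.
move=> z0 pn0 p0.
pose f (x : R) := p.[x] * expR (- x ^+ 2).
have f0 x : `[- z, z]%classic x -> 0 <= f x.
  by rewrite /= in_itv /= => /p0 px; rewrite mulr_ge0 ?expR_ge0.
rewrite lt_neqAle Rintegral_ge0 // andbT; apply/negP => /eqP I0.
have intf := integrable_poly_gauss p z; have mf := measurable_int _ intf.
have [] := ae_eq_integral_abs lebesgue_measure (measurable_itv `[- z, z]) mf.
have -> : (\int[lebesgue_measure]_(x in `[(- z)%R, z]) `|(f x)%:E|)%E = 0%E.
  transitivity (\int[lebesgue_measure]_(x in `[(- z)%R, z]) (f x)%:E)%E.
    by apply: eq_integral => x /set_mem /f0 fx; rewrite /= ger0_norm.
  by rewrite -[LHS]fineK ?integrable_fin_num // -[fine _]/(truncL z p) -I0.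
move=> /(_ erefl) ae0 _.
have rootsN : lebesgue_measure.-negligible [set x : R | root p x]%classic.
  apply/negligibleP.
    apply: countable_measurable => //.
    exact/finite_set_countable/finite_roots.
  exact/countable_lebesgue_measure0/finite_set_countable/finite_roots.
have : lebesgue_measure.-negligible (`[- z, z]%classic : set R).
  (* A point of the interval is either a root of [p] or a point where the integrand is nonzero. *)
  apply: (negligibleS _ (negligibleU ae0 rootsN)) => x xz /=.
  have [px|px] := boolP (root p x); [by right|left => /= H].
  move: (H xz) => [] /eqP; rewrite mulf_eq0 (gt_eqF (expR_gt0 _)) orbF.
  by rewrite -/(root p x) (negPf px).
move=> N; have mu0 : lebesgue_measure (`[- z, z]%classic : set R) = 0%E.
  apply: measure_negligible N; exact: measurable_itv.
have := lebesgue_measure_itv `[- z, z].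
rewrite mu0 /= lte_fin ifT; last by lra.
by move/esym/eqP; rewrite -EFinB eqe; lra.
Qed.
End TruncatedFunctional.

(** * Truncated Hermite polynomials *)

Lemma coef_comp_oppX (R : comNzRingType) (p : {poly R}) i :
  (p \Po (- 'X))`_i = (-1) ^+ i * p`_i.
Proof.
elim/poly_ind: p i => [|p c IH] i; first by rewrite comp_poly0 coef0 mulr0.
rewrite comp_polyD comp_polyM comp_polyX comp_polyC mulrN !coefD coefN !coefMX.
rewrite !coefC; case: i => [|i] /=; first by rewrite expr0; ring.
by rewrite IH exprS; ring.
Qed.

Section TruncatedHermite.
Context {R : realType}.
Variables (z : R) (P : nat -> {poly R}).
Hypotheses (z_gt0 : 0 < z) (hP : truncated_hermite z P).
Implicit Types (p q d : {poly R}) (m n : nat).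
Local Notation L := (truncL z).
Local Notation h := (hnorm z P).
Local Notation g := (gammaP z P).

Lemma coef_lead n : (P n)`_n = 1.
Proof.
by have [/(_ n)/monicP + /(_ n) sP _] := hP; rewrite lead_coefE sP.
Qed.

Lemma coef_gt n j : (n < j)%N -> (P n)`_j = 0.
Proof. by have [_ sP _] := hP => nj; rewrite nth_default ?sP. Qed.

Lemma hermite_neq0 n : P n != 0.
Proof. by have [_ sP _] := hP; rewrite -size_poly_eq0 sP. Qed.

Lemma hnorm_gt0 n : 0 < h n.
Proof.
apply: truncL_gt0 => //; first by rewrite expf_neq0 ?hermite_neq0.
by move=> x _; rewrite horner_exp sqr_ge0.
Qed.

(** Induction on a bound for the size of [q]: subtracting a multiple of the monic [P m] removes its
    top coefficient. *)
Lemma truncL_lower n q : (size q <= n)%N -> L (P n * q) = 0.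
Proof.
have [_ sP oP] := hP.
suff H m : forall q, (size q <= m)%N -> (m <= n)%N -> L (P n * q) = 0.
  by move=> sq; apply: (H n).
elim: m => [|m IH] {}q sq mn.
  by move: sq; rewrite leqn0 size_poly_eq0 => /eqP ->; rewrite mulr0 truncL0.
have -> : P n * q = P n * (q - q`_m *: P m) + q`_m *: (P n * P m).
  by rewrite mulrBr scalerAr subrK.
rewrite truncLD truncLZ oP gtn_eqF // mulr0 addr0 IH //; last exact: ltnW.
apply/leq_sizeP => j; rewrite leq_eqVlt => /predU1P[<-|mj].
  by rewrite coefB coefZ coef_lead mulr1 subrr.
by rewrite coefB coefZ coef_gt // mulr0 subr0 nth_default // (leq_trans sq).
Qed.

Lemma truncL_coef n q : (size q <= n.+1)%N -> L (P n * q) = q`_n * h n.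
Proof.
move=> sq; have [_ sP oP] := hP.
have -> : P n * q = P n * (q - q`_n *: P n) + q`_n *: (P n * P n).
  by rewrite mulrBr scalerAr subrK.
rewrite truncLD truncLZ oP eqxx truncL_lower ?add0r //.
apply/leq_sizeP => j; rewrite leq_eqVlt => /predU1P[<-|nj].
  by rewrite coefB coefZ coef_lead mulr1 subrr.
by rewrite coefB coefZ coef_gt // mulr0 subr0 nth_default // (leq_trans sq).
Qed.

(** Testing with [q := d] contradicts $L[d^2]>0$. The identities below are all proved this way: the
    coefficients of the difference vanish from degree [n] on, and the difference is orthogonal to
    every polynomial of lower degree. *)
Lemma truncL_orthogonal_eq0 n d : (size d <= n)%N ->
  (forall q, (size q <= n)%N -> L (d * q) = 0) -> d = 0.
Proof.
move=> sd od; apply/eqP; apply: contraT => dn0.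
have : 0 < L (d * d); last by rewrite od ?ltxx.
apply: truncL_gt0 => //; first by rewrite mulf_neq0.
by move=> x _; rewrite hornerM -expr2 sqr_ge0.
Qed.

(** Both sides have the same leading term, and by the symmetry of $L$ both are orthogonal to lower
    degrees. *)
Lemma hermite_comp_oppX n : P n \Po (- 'X) = (-1) ^+ n *: P n.
Proof.
apply/eqP; rewrite -subr_eq0; apply/eqP.
apply: (@truncL_orthogonal_eq0 n).
  apply/leq_sizeP => j; rewrite coefB coefZ coef_comp_oppX.
  rewrite leq_eqVlt => /predU1P[<-|nj]; first by rewrite subrr.
  by rewrite coef_gt // !mulr0 subrr.
move=> q sq; rewrite mulrBl -scalerAl truncLB truncLZ.
rewrite (truncL_lower _ _ sq) mulr0.
rewrite subr0 -(truncL_comp_oppX _ _ (ltW z_gt0)) comp_polyM -comp_polyA.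
rewrite linearN /= comp_polyX opprK comp_polyXr truncL_lower //.
apply/leq_sizeP => j jn; rewrite coef_comp_oppX nth_default ?mulr0 //.
exact: leq_trans sq jn.
Qed.

Lemma coef_sublead n : (P n.+1)`_n = 0.
Proof.
have := congr1 (fun p : {poly R} => p`_n) (hermite_comp_oppX n.+1).
rewrite coef_comp_oppX coefZ exprS mulN1r mulNr => /eqP.
rewrite -subr_eq0 opprK -mulr2n mulrn_eq0 /= mulf_eq0.
by rewrite expf_eq0 oppr_eq0 oner_eq0 andbF => /eqP.
Qed.

Lemma gammaM m : g m.+1 * h m = h m.+1.
Proof. by rewrite /gammaP /= divfK // gt_eqF ?hnorm_gt0. Qed.

(** Parity removes the coefficient of degree [m.+1] from the difference. Against [q] of degree at
    most [m], only $q_m h_{m+1}-\gamma_{m+1}q_m h_m=0$ remains. *)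
Lemma hermite_recurrence m : 'X * P m.+1 = P m.+2 + (g m.+1)%:P * P m.
Proof.
apply/eqP; rewrite -subr_eq0; apply/eqP.
apply: (@truncL_orthogonal_eq0 m.+1).
  apply/leq_sizeP => j; rewrite coefB coefD coefCM coefXM.
  rewrite leq_eqVlt => /predU1P[<-|] /=.
    by rewrite !coef_sublead coef_gt // mulr0 addr0 subr0.
  rewrite leq_eqVlt => /predU1P[<-|] /=.
    by rewrite !coef_lead coef_gt //; ring.
  by case: j => //= j mj; rewrite !coef_gt //; try lia; ring.
move=> q sq.
have -> : ('X * P m.+1 - (P m.+2 + (g m.+1)%:P * P m)) * q =
   P m.+1 * ('X * q) - (P m.+2 * q + g m.+1 *: (P m * q)).
  by rewrite -mul_polyC; ring.
rewrite truncLB truncLD truncLZ.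
rewrite (truncL_lower _ _ (leqW sq)) (truncL_coef _ _ sq).
rewrite truncL_coef; last first.
  apply/leq_sizeP => -[|j] // mj.
  by rewrite coefXM /= nth_default ?(leq_trans sq).
by rewrite coefXM /= add0r -gammaM; ring.
Qed.

(** * Pearson identity and ladder relations *)

Let phi : {poly R} := 'X ^+ 2 - (z ^+ 2)%:P.

Lemma truncL_pearson q : L ((phi * q)^`() - 2%:P * 'X * (phi * q)) = 0.
Proof. by rewrite truncL_deriv // !hornerE; ring. Qed.

(** Nested products by ['X] let coefficients be read off by index shifts. *)
Let phiM q : phi * q = 'X * ('X * q) - (z ^+ 2)%:P * q.
Proof. by rewrite /phi; ring. Qed.

Let coef_XXderiv p j : ('X * ('X * p^`()))`_j.+1 = p`_j *+ j.
Proof.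
by rewrite !coefXM /=; case: j => [|j] /=; rewrite ?mulr0n ?coef_deriv.
Qed.

Let coef_deriv_phiM q m : (size q <= m.+1)%N ->
  (phi * q)^`()`_m.+1 = q`_m *+ m.+2.
Proof.
move=> sq; rewrite coef_deriv phiM coefB coefCM !coefXM /=.
by rewrite (nth_default _ (leqW sq)) mulr0 subr0.
Qed.

Let coef_XP m : ('X * P m)`_m = 0.
Proof. by rewrite coefXM; case: m => [|m] //=; rewrite coef_sublead. Qed.

(** The factor [m.+1%:R - 2 * g m.+1] is forced by the coefficients of degree [m.+2], and the value
    of [zeta2] by orthogonality to $x^m$. *)
Lemma hermite_ladder_down m :
  phi * (P m.+1)^`() =
  (2 * g m.+1)%:P * ('X ^+ 2 - (zeta2 z P m.+1)%:P) * P m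
  + (m.+1%:R - 2 * g m.+1)%:P * 'X * P m.+1.
Proof.
set c := g m.+1; set t := zeta2 z P m.+1.
apply/eqP; rewrite -subr_eq0; apply/eqP.
have -> : phi * (P m.+1)^`() -
  ((2 * c)%:P * ('X ^+ 2 - t%:P) * P m + (m.+1%:R - 2 * c)%:P * 'X * P m.+1)
  = 'X * ('X * (P m.+1)^`()) - (z ^+ 2)%:P * (P m.+1)^`()
  - (2 * c)%:P * ('X * ('X * P m)) + (2 * c * t)%:P * P m
  - (m.+1%:R - 2 * c)%:P * ('X * P m.+1).
  by rewrite phiM; ring.
set D := (X in X = 0).
apply: (@truncL_orthogonal_eq0 m.+1).
  apply/leq_sizeP => j; rewrite /D !(coefB, coefD) !coefCM.
  rewrite leq_eqVlt => /predU1P[<-|].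
    rewrite coef_XXderiv coef_deriv (coefXM ('X * P m)) coef_XP.
    by rewrite coefXM /= coef_sublead !coef_gt //; ring.
  rewrite leq_eqVlt => /predU1P[<-|].
    rewrite coef_XXderiv coef_deriv !coefXM /= !coef_lead.
    by rewrite !coef_gt //; ring.
  case: j => [|[|j]] // mj; rewrite coef_XXderiv coef_deriv !coefXM /=.
  by rewrite !coef_gt //; try lia; ring.
move=> q sq.
(* The cofactor of [P m.+1] once the Pearson identity has moved the derivative onto [phi * q] and
   the recurrence has absorbed $2x^3P_{m+1}-2cx^2P_m$ into $2x^2P_{m+2}$. *)
pose W : {poly R} := (- (2 * z ^+ 2))%:P * ('X * q) - (phi * q)^`()
   - (m.+1%:R - 2 * c)%:P * ('X * q).
have -> : D * q = ((phi * (P m.+1 * q))^`() - 2%:P * 'X * (phi * (P m.+1 * q)))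
   + (2 *: (P m.+2 * ('X * ('X * q))) + P m.+1 * W + (2 * c * t) *: (P m * q)).
  have -> : P m.+2 = 'X * P m.+1 - c%:P * P m.
    by rewrite hermite_recurrence addrK.
  rewrite /D /W -!mul_polyC mulrCA !derivM /phi; ring.
rewrite truncLD truncL_pearson add0r 2!truncLD 2!truncLZ.
rewrite !truncL_coef //.
(* Each term is a multiple of $q_m h_{m+1}$; their sum is zero exactly by the definition of
   $\zeta^2_{m+1}$. *)
- rewrite /W !coefB !coefCM coef_deriv_phiM // !coefXM /=.
  rewrite /t /zeta2 -/c -(gammaM m.+1) -(gammaM m) -/c -(mulr_natr _ m.+2).
  by field.
- apply/leq_sizeP => -[|j] // mj; rewrite /W !coefB !coefCM.
  rewrite coef_deriv phiM coefB coefCM !coefXM /=.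
  case: j mj => // j mj.
  by rewrite !(nth_default _ (leq_trans sq _)) //; try lia; ring.
- apply/leq_sizeP => -[|[|j]] // mj.
  by rewrite !coefXM nth_default ?(leq_trans sq) //; lia.
Qed.

(** The constant [c] stays existential because its term is a multiple of [P m.+1], hence zero at the
    zeros where the relation is evaluated. *)
Lemma hermite_ladder_up m : exists c : R,
  phi * (P m)^`() =
  2%:P * 'X * phi * P m - (m.+1%:R - 2 * g m.+1)%:P * 'X * P m
  + (c%:P - 2%:P * 'X ^+ 2) * P m.+1.
Proof.
set b := g m.+1.
pose G : {poly R} := 'X * ('X * (P m)^`()) - (z ^+ 2)%:P * (P m)^`()
  - 2%:P * ('X * ('X * ('X * P m)))
  + (2 * z ^+ 2 + m.+1%:R - 2 * b)%:P * ('X * P m)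
  + 2%:P * ('X * ('X * P m.+1)).
(* [G] gathers all terms but $cP_{m+1}$, so it has to equal $cP_{m+1}$; as [P m.+1] is monic, [c] is
   its coefficient of degree [m.+1]. *)
exists G`_m.+1; apply/eqP; rewrite -subr_eq0; apply/eqP.
have -> : phi * (P m)^`() -
  (2%:P * 'X * phi * P m - (m.+1%:R - 2 * b)%:P * 'X * P m
  + ((G`_m.+1)%:P - 2%:P * 'X ^+ 2) * P m.+1) = G - (G`_m.+1)%:P * P m.+1.
  by rewrite /G /phi; ring.
apply: (@truncL_orthogonal_eq0 m.+1).
  apply/leq_sizeP => j; rewrite coefB coefCM.
  rewrite leq_eqVlt => /predU1P[<-|mj]; first by rewrite coef_lead mulr1 subrr.
  rewrite (coef_gt _ _ mj) mulr0 subr0 /G !(coefB, coefD) !coefCM.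
  move: mj; rewrite leq_eqVlt => /predU1P[<-|].
    have := coef_XP m; rewrite coefXM coef_XXderiv coef_deriv !coefXM /= => ->.
    by rewrite coef_sublead !coef_gt ?mul0rn; try lia; ring.
  rewrite leq_eqVlt => /predU1P[<-|].
    rewrite coef_XXderiv coef_deriv !coefXM /= !coef_lead.
    by rewrite !coef_gt ?mul0rn; try lia; ring.
  case: j => [|[|[|j]]] // mj; rewrite coef_XXderiv coef_deriv !coefXM /=.
  by rewrite !coef_gt ?mul0rn; try lia; ring.
move=> q sq.
(* The cofactor of [P m] after the Pearson identity and the recurrence. Its degree may reach [m.+1],
   so a multiple of [P m.+1] is subtracted from it below and regrouped with [P m.+1]. *)
pose U : {poly R} := (m.+1%:R)%:P * ('X * q) - (phi * q)^`().
have Um1 : U`_m.+1 = - q`_m.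
  by rewrite /U coefB coefCM coefXM /= coef_deriv_phiM //; ring.
have -> : (G - (G`_m.+1)%:P * P m.+1) * q =
   ((phi * (P m * q))^`() - 2%:P * 'X * (phi * (P m * q)))
   + (2 *: (P m.+2 * ('X * q)) + P m * (U - U`_m.+1 *: P m.+1)
   + P m.+1 * (U`_m.+1 *: P m - G`_m.+1 *: q)).
  have -> : P m.+2 = 'X * P m.+1 - b%:P * P m.
    by rewrite hermite_recurrence addrK.
  rewrite /U -!mul_polyC mulrCA !derivM; move: (G`_m.+1) (U`_m.+1) => x y.
  by rewrite /G /phi; ring.
rewrite truncLD truncL_pearson add0r 2!truncLD truncLZ.
rewrite (truncL_lower m.+2) 1?(truncL_lower m.+1) 1?truncL_coef //.
(* The coefficient of degree [m] in [U] is zero: both of its terms contribute $(m+1)q_{m-1}$, with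
   opposite signs. *)
- rewrite coefB coefZ coef_sublead !mulr0 subr0 add0r addr0 /U coefB coefCM.
  rewrite coef_deriv phiM coefB coefCM !coefXM /= (nth_default _ sq).
  by case: (m) => [|i] /=; ring.
- apply/leq_sizeP => j; rewrite coefB coefZ leq_eqVlt => /predU1P[<-|mj].
    by rewrite coef_lead mulr1 subrr.
  rewrite coef_gt // mulr0 subr0 /U coefB coefCM coef_deriv phiM coefB coefCM.
  case: j mj => [|j] // mj; rewrite !coefXM /=.
  by rewrite !(nth_default _ (leq_trans sq _)) //; try lia; ring.
- apply/leq_sizeP => j mj; rewrite coefB !coefZ coef_gt //.
  by rewrite (nth_default _ (leq_trans sq mj)) !mulr0 subr0.
- by apply/leq_sizeP => -[|j] // mj; rewrite coefXM nth_default ?(leq_trans sq).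
Qed.
End TruncatedHermite.

(** * Location of the zeros, and the differential equation at a zero *)

Section Zeros.
Context {R : realType}.
Variables (z : R) (P : nat -> {poly R}).
Hypotheses (z_gt0 : 0 < z) (hP : truncated_hermite z P).

(** With $P_n=(x-r)q$, orthogonality gives $L[(x-r)q^2]=L[P_nq]=0$; for $r$ outside $(-z,z)$ the
    integrand would have constant sign on the interval. *)
Lemma hermite_zero_bounds n (r : R) : root (P n) r -> - z < r < z.
Proof.
case/factor_theorem => q Pq.
have qn0 : q != 0.
  by apply: contraTneq (hermite_neq0 _ _ hP n) => q0; rewrite Pq q0 mul0r eqxx.
have sq : (size q <= n)%N.
  have [_ /(_ n) + _] := hP.
  by rewrite Pq size_Mmonic ?monicXsubC // size_XsubC addn2 => -[->].
have L0 : truncL z (('X - r%:P) * (q * q)) = 0.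
  by rewrite mulrCA mulrA -Pq (truncL_lower z P hP).
have XqE (y : R) : (('X - r%:P) * (q * q)).[y] = (y - r) * q.[y] ^+ 2.
  by rewrite !hornerE; ring.
have X0 : ('X - r%:P) * (q * q) != 0 by rewrite !mulf_neq0 ?polyXsubC_eq0.
apply/andP; split; rewrite ltNge; apply/negP => rz.
  suff H : 0 < truncL z (('X - r%:P) * (q * q)) by rewrite L0 ltxx in H.
  apply: truncL_gt0 => // y /andP[zy _].
  by rewrite XqE mulr_ge0 ?sqr_ge0 //; lra.
suff H : 0 < truncL z (- (('X - r%:P) * (q * q))).
  by rewrite truncLN L0 oppr0 ltxx in H.
apply: truncL_gt0 => //; first by rewrite oppr_eq0.
move=> y /andP[_ yz]; rewrite hornerN XqE -mulNr mulr_ge0 ?sqr_ge0 //; lra.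
Qed.

Lemma hermite_ode_root m (r : R) (t := zeta2 z P m.+1) :
  root (P m.+1) r -> (P m.+1)^`().[r] != 0 ->
  r ^+ 2 - t != 0 /\
  (P m.+1)^`()^`().[r] =
    (2 * r - 2 * r / (r ^+ 2 - z ^+ 2) + 2 * r / (r ^+ 2 - t))
    * (P m.+1)^`().[r].
Proof.
move=> rP P'0.
have f0 : r ^+ 2 - z ^+ 2 != 0.
  have /andP[r1 r2] := hermite_zero_bounds _ _ rP.
  by apply: ltr0_neq0; nra.
have [c E2] := hermite_ladder_up z P z_gt0 hP m.
have := hermite_ladder_down z P z_gt0 hP m.
move: (gammaP _ _ _) E2 => g E2 E1.
have {E2} := congr1 (horner^~ r) E2.
have := congr1 (fun p : {poly R} => p^`().[r]) E1.
have {E1} := congr1 (horner^~ r) E1.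
rewrite -/t !(derivM, derivD, derivN, derivC, derivX, derivXn) !hornerE /=.
rewrite (rootP rP) {rP} !(mulr0, addr0) /=.
move: (P m.+1)^`().[r] (P m.+1)^`()^`().[r] (P m).[r] (P m)^`().[r] P'0.
move: f0; set f := r ^+ 2 - z ^+ 2; set s := r ^+ 2 - t; set k := _ - 2 * g.
move=> f0 p1 p2 q q1 p1n0 E1 E3 E2.
(* [E1] reads $f p_1=2gsq$, with nonzero left side. *)
have s0 : s != 0.
  by apply: contra_eq_neq E1 => ->; rewrite mulr0 mul0r mulf_neq0.
split=> //.
(* The outer factor [f] appears because [E2] determines [q1] only through [f * q1]; it is cancelled
   afterwards. *)
have : f * (f * s * p2 - (2 * r * f * s - 2 * r * s + 2 * r * f) * p1) = 0.
  (* Certificate eliminating q and q1 by means of E3, E2 and E1. *)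
  transitivity (s * f * ((r + r - 0) * p1 + f * p2
      - (2 * g * (r + r - 0) * q + 2 * g * s * q1 + k * r * p1))
    + 2 * g * s * s * (f * q1 - (2 * r * f * q - k * r * q))
    + (s * k * r - 2 * r * f - 2 * r * f * s) * (f * p1 - 2 * g * s * q)).
    by ring.
  by rewrite E1 E2 E3 !subrr !mulr0 !addr0.
move/eqP; rewrite mulf_eq0 (negPf f0) subr_eq0 /= => /eqP fsp2.
have fs0 : f * s != 0 by rewrite mulf_neq0.
by apply: (mulfI fs0); rewrite fsp2; field; rewrite f0 s0.
Qed.
End Zeros.

(** * The energy *)

Section Derivatives.
Context {R : realType}.

Lemma horner_deriv_prod_XsubC (I : finType) (A : pred I) (a : I -> R) (y : R) :
  (forall i, A i -> y != a i) ->
  (\prod_(i | A i) ('X - (a i)%:P))^`().[y] =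
  (\prod_(i | A i) ('X - (a i)%:P)).[y] * \sum_(i | A i) (y - a i)^-1.
Proof.
move=> ya.
elim/big_rec2: _ => [|i s p Ai IH]; first by rewrite derivC !hornerE.
rewrite derivM !hornerE IH derivXsubC !hornerE /=.
field; by rewrite subr_eq0 ya.
Qed.

(** Both derivatives are limits of the same difference quotient, so partial derivatives reduce to
    one real variable. *)
Lemma is_derive_along (V : normedModType R) (f : V -> R) (x v : V) (df : R) :
  is_derive (0 : R) 1 (fun t : R => f (t *: v + x)) df -> is_derive x v f df.
Proof.
move=> [D E].
have eqf : (fun h : R => h^-1 *:
    (((fun t : R => f (t *: v + x)) \o shift 0) (h *: 1) - f (0 *: v + x)))
  = (fun h : R => h^-1 *: ((f \o shift x) (h *: v) - f x)).
  by apply/funext => h /=; rewrite scale0r add0r addr0 [h *: 1]mulr1.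
split; first by move: D; rewrite /derivable eqf.
by rewrite -E /derive eqf.
Qed.

Lemma is_derive_bigsum (I : Type) (r : seq I) (A : pred I) (h : I -> R -> R)
    (dh : I -> R) (t : R) :
  (forall i, A i -> is_derive t 1 (h i) (dh i)) ->
  is_derive t 1 (fun s => \sum_(i <- r | A i) h i s) (\sum_(i <- r | A i) dh i).
Proof.
move=> H; elim: r => [|i r IH].
  rewrite big_nil; under eq_fun do rewrite big_nil; exact: is_derive_cst.
rewrite big_cons; under eq_fun do rewrite big_cons.
by case: ifP => // Ai; apply: is_deriveD; apply: H.
Qed.

(** Writing $\ln|u|=\frac12\ln(u^2)$ avoids differentiating the absolute value. *)
Lemma is_derive_ln_norm (u : R -> R) (du t : R) :
  is_derive t 1 u du -> u t != 0 ->
  is_derive t 1 (fun s => ln `|u s|) (du / u t).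
Proof.
move=> D u0.
(* This covers u s = 0 as well, because ln 0 = 0. *)
have lnE s : ln `|u s| = 2^-1 * ln (u s ^+ 2).
  have [->|us0] := eqVneq (u s) 0.
    by rewrite normr0 expr0n /= ln0 // mulr0.
  rewrite -[u s ^+ 2]real_normK ?num_real // lnXn ?normr_gt0 // mulr2n.
  by field.
under eq_fun do rewrite lnE.
have D2 : is_derive t 1 (fun s => u s ^+ 2) (2 * u t * du).
  by apply: is_derive_eq; rewrite /GRing.scale /=; ring.
have u2 : 0 < u t ^+ 2 by rewrite exprn_even_gt0.
have D3 := @is_derive1_comp _ (@ln R) (fun s => u s ^+ 2) _ _ _
  (is_derive1_ln u2) D2.
have D4 := is_deriveZ (2^-1) D3.
apply: is_derive_eq; rewrite /GRing.scale /=; field; exact u0.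
Qed.
End Derivatives.

(** The left side is the derivative of the pair interaction when only coordinate [k] moves: pairs
    with [i = k] give the terms $j<k$, pairs with [j = k] those above [k]. *)
Lemma sum_pair_delta (R : fieldType) n (a : 'I_n -> R) (k : 'I_n) :
  \sum_(i < n) \sum_(j < n | (j < i)%N)
    ((i == k)%:R - (j == k)%:R) / (a i - a j) =
  \sum_(j < n | j != k) (a k - a j)^-1.
Proof.
rewrite [RHS](bigID (fun j : 'I_n => (j < k)%N)) /=.
under eq_bigr do (under eq_bigr do rewrite mulrBl; rewrite big_split /=).
rewrite big_split /=; congr (_ + _).
  rewrite (bigD1 k) //= [X in _ + X]big1 ?addr0; last first.
    move=> i /negPf ik; apply: big1 => j _; by rewrite ik mul0r.
  apply: eq_big => [j|j _]; last by rewrite eqxx mul1r.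
  by rewrite -val_eqE /=; case: ltngtP.
(* Exchanging the sums isolates [j = k]; its minus sign turns $a_i-a_k$ into $a_k-a_i$. *)
rewrite (exchange_big_dep xpredT) //= (bigD1 k) //=.
rewrite [X in _ + X]big1 ?addr0; last first.
  by move=> j /negPf jk; apply: big1 => i _; rewrite jk mul0r oppr0.
apply: eq_big => [j|j _]; first by rewrite -val_eqE /=; case: ltngtP.
by rewrite eqxx mul1r -invrN opprB.
Qed.

(** Stated along a curve [u], to be applied to the coordinates $x_i+t\,\delta_{ik}$. *)
Lemma is_derive_potential (R : realType) (z : R) (P : nat -> {poly R}) n
    (u : R -> R) (du t : R) : is_derive t 1 u du ->
  u t ^+ 2 - z ^+ 2 != 0 -> u t ^+ 2 - zeta2 z P n != 0 ->
  is_derive t 1 (fun s => potential z P n (u s))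
    ((2 * u t - 2 * u t / (u t ^+ 2 - z ^+ 2)
       + 2 * u t / (u t ^+ 2 - zeta2 z P n)) * du).
Proof.
move=> D n1 n2.
have D2 c : is_derive t 1 (fun s => u s ^+ 2 - c) (2 * u t * du).
  by apply: is_derive_eq; rewrite /GRing.scale /=; ring.
have D1 : is_derive t 1 (fun s => u s ^+ 2) (2 * u t * du).
  by apply: is_derive_eq; rewrite /GRing.scale /=; ring.
have L1 := is_derive_ln_norm _ _ _ (D2 _) n1.
have L2 := is_derive_ln_norm _ _ _ (D2 _) n2.
have H := is_deriveD (is_deriveB D1 L1) L2.
by apply: is_derive_eq H _; field; rewrite n1 n2.
Qed.

Lemma is_derive_energy (R : realType) (z : R) (P : nat -> {poly R}) n
    (x : 'rV[R]_n) (k : 'I_n) :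
  (forall i j, i != j -> x 0 i != x 0 j) ->
  (forall i, x 0 i ^+ 2 - z ^+ 2 != 0) ->
  (forall i, x 0 i ^+ 2 - zeta2 z P n != 0) ->
  is_derive x (delta_mx 0 k : 'rV[R]_n) (energy z P (n := n))
    (- 2 * (\sum_(j < n | j != k) (x 0 k - x 0 j)^-1)
     + (2 * x 0 k - 2 * x 0 k / (x 0 k ^+ 2 - z ^+ 2)
         + 2 * x 0 k / (x 0 k ^+ 2 - zeta2 z P n))).
Proof.
move=> inj nz nzeta; apply: is_derive_along; rewrite /energy.
have yE i (t : R) :
    (t *: (delta_mx 0 k : 'rV[R]_n) + x) 0 i = x 0 i + t * (i == k)%:R.
  by rewrite !mxE eqxx addrC.
have Dy i :
    is_derive (0 : R) 1 (fun t : R => x 0 i + t * (i == k)%:R) (i == k)%:R.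
  by apply: is_derive_eq; rewrite /GRing.scale /=; ring.
under eq_fun => t do
  (under eq_bigr => i _ do (under eq_bigr => j _ do rewrite !yE);
   under [X in _ + X]eq_bigr => i _ do rewrite yE).
have y0 i : x 0 i + 0 * (i == k)%:R = x 0 i by rewrite mul0r addr0.
rewrite -(sum_pair_delta _ _ (fun j => x 0 j)).
apply: is_derive_eq.
  apply: is_deriveD.
    apply: (is_deriveZ (- 2)); apply: is_derive_bigsum => i _.
    apply: is_derive_bigsum => j ji.
    apply: (is_derive_ln_norm _ ((i == k)%:R - (j == k)%:R)).
    by rewrite !y0 subr_eq0 inj // -val_eqE /= gtn_eqF.
  apply: is_derive_bigsum => i _.
  by apply: (is_derive_potential _ _ _ _ _ _ _ (Dy i)); rewrite ?y0.
congr (_ + _).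
  rewrite /GRing.scale /=; congr (_ * _).
  by apply: eq_bigr => i _; apply: eq_bigr => j _; rewrite !y0.
rewrite (bigD1 k) //= big1 ?addr0; last by move=> i /negPf ->; rewrite mulr0.
by rewrite !y0 eqxx mulr1.
Qed.

(** * The zeros as equilibrium positions *)

Theorem theorem21 (R : realType) (z : R) (hz : 0 < z)
    (P : nat -> {poly R}) (hP : truncated_hermite z P)
    (n : nat) (hn : (1 <= n)%N)
    (x : 'rV[R]_n) (hx : increasing_zeros (P n) x) :
  (forall k : 'I_n, - z < x 0 k < z) /\
  critical_point (energy z P (n := n)) x.
Proof.
case: hx => mono rootE.
have xroot i : root (P n) (x 0 i) by apply/rootE; exists i.
have bounds i := hermite_zero_bounds z P hz hP n _ (xroot i).
split=> // k.
have inj i j : i != j -> x 0 i != x 0 j.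
  by rewrite -val_eqE /= neq_ltn => /orP[] /mono; [move/lt_eqF->|move/gt_eqF->].
(* A monic polynomial of degree [n] with [n] distinct roots splits. *)
have PnE : P n = \prod_(j < n) ('X - (x 0 j)%:P).
  have [monP sP _] := hP.
  rewrite [LHS](@all_roots_prod_XsubC _ _ [seq x 0 j | j <- enum 'I_n]).
  - by rewrite (monicP (monP n)) scale1r big_map big_enum.
  - by rewrite sP size_map size_enum_ord.
  - by apply/allP => _ /mapP[j _ ->].
  - rewrite uniq_rootsE map_inj_uniq ?enum_uniq // => i j /eqP xij.
    by apply/eqP; apply: contraTT xij; exact: inj.
(* From $P_n=(x-x_i)S_i$ follow $P_n'(x_i)=S_i(x_i)$ and $P_n''(x_i)=2S_i'(x_i)$. *)
pose S i := \prod_(j < n | j != i) ('X - (x 0 j)%:P).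
have PS i : P n = ('X - (x 0 i)%:P) * S i by rewrite PnE (bigD1 i).
have Sn0 i : (S i).[x 0 i] != 0.
  rewrite horner_prod; apply/prodf_neq0 => j ji.
  by rewrite !hornerE subr_eq0 inj // eq_sym.
have P'E i : (P n)^`().[x 0 i] = (S i).[x 0 i].
  by rewrite (PS i) derivM derivXsubC !hornerE subrr; ring.
have P''E i : (P n)^`()^`().[x 0 i] =
    (S i).[x 0 i] * (2 * \sum_(j < n | j != i) (x 0 i - x 0 j)^-1).
  have -> : (P n)^`()^`().[x 0 i] = 2 * (S i)^`().[x 0 i].
    rewrite (PS i) derivM derivXsubC mul1r derivD derivM derivXsubC mul1r.
    by rewrite !hornerD hornerM hornerXsubC subrr; ring.
  rewrite (horner_deriv_prod_XsubC _ _ (fun j => x 0 j)).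
    by rewrite -/(S i); ring.
  by move=> j; rewrite eq_sym; exact: inj.
(* The ladder relations concern [P m.+1], so [n] is replaced by a successor. *)
case: n hn x @S mono rootE xroot bounds k inj PnE PS Sn0 P'E P''E => // m _ x S.
move=> mono rootE xroot bounds k inj PnE PS Sn0 P'E P''E.
have P'0 i : (P m.+1)^`().[x 0 i] != 0 by rewrite P'E.
have ode i := hermite_ode_root z P hz hP m _ (xroot i) (P'0 i).
have f0 i : x 0 i ^+ 2 - z ^+ 2 != 0.
  have /andP[r1 r2] := bounds i; apply: ltr0_neq0; nra.
apply: is_derive_eq.
  by apply: is_derive_energy => // i; have [] := ode i.
(* Cancelling $S_k(x_k)$ equates $V_n'(x_k)$ with the doubled sum of the $1/(x_k-x_j)$. *)
have [t0] := ode k; rewrite P''E P'E mulrC => /(mulIf (Sn0 k)) <-.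
ring.
Qed.
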